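(* Let $q$ be an odd prime power and let $n$ be a positive integer. Let $a\in U(\mathbb{F}_q)$. Then $$|ST_n(\mathbb{F}_q,a)|=\begin{cases}\dfrac{|IST_n(\mathbb{F}_q)|+S_n(\mathbb{F}_q)}{q-1} & \text{if } a\in Q(\mathbb{F}_q),\\[8pt] \dfrac{|IST_n(\mathbb{F}_q)|-S_n(\mathbb{F}_q)}{q-1} & \text{if } a\in N(\mathbb{F}_q).\end{cases}$$
   Context: $\mathbb{F}_q$ is the finite field with $q$ elements and $U(\mathbb{F}_q)$ is its group of units (nonzero elements). $Q(\mathbb{F}_q)=\{a\in U(\mathbb{F}_q): a=x^2 \text{ for some } x\in\mathbb{F}_q\}$ and $N(\mathbb{F}_q)=U(\mathbb{F}_q)\setminus Q(\mathbb{F}_q)$. $\chi$ is the quadratic character of $\mathbb{F}_q$: $\chi(0)=0$, $\chi(a)=1$ for $a\in Q(\mathbb{F}_q)$, $\chi(a)=-1$ for $a\in N(\mathbb{F}_q)$. For $n\ge 1$, $ST_n(\mathbb{F}_q)$ is the set of $n\times n$ symmetric tridiagonal matrices over $\mathbb{F}_q$, i.e. symmetric matrices whose entries outside the main diagonal, the subdiagonal and the superdiagonal are zero. $ST_n(\mathbb{F}_q,a)=\{A\in ST_n(\mathbb{F}_q):\det(A)=a\}$ and $IST_n(\mathbb{F}_q)=\{A\in ST_n(\mathbb{F}_q):\det(A)\ne 0\}$. Finally, $S_n(\mathbb{F}_q)=\sum_{a\in U(\mathbb{F}_q)}\chi(a)\,|ST_n(\mathbb{F}_q,a)|$. *)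

(* Defs.v *)
From mathcomp Require Import all_boot all_order all_algebra.

Set Implicit Arguments.
Unset Strict Implicit.
Unset Printing Implicit Defensive.

Import GRing.Theory Num.Theory.

Local Open Scope ring_scope.

Definition Uset (F : finFieldType) : {set F} :=
  [set a : F | a \is a GRing.unit].

Definition Qset (F : finFieldType) : {set F} :=
  [set a in Uset F | [exists x : F, a == x ^+ 2]].

Definition Nset (F : finFieldType) : {set F} := Uset F :\: Qset F.

(* Uset F is the disjoint union of Qset F and Nset F, so the last branch
   is the case a = 0. *)
Definition chi (F : finFieldType) (a : F) : int :=
  if a \in Qset F then 1 else if a \in Nset F then -1 else 0.

Definition symmetric_mx (F : finFieldType) (n : nat) (A : 'M[F]_n) : bool :=
  A^T == A.

Definition tridiagonal_mx (F : finFieldType) (n : nat) (A : 'M[F]_n) : bool :=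
  [forall i : 'I_n, forall j : 'I_n,
     ((i.+1 < j)%N || (j.+1 < i)%N) ==> (A i j == 0)].

Definition ST (F : finFieldType) (n : nat) : {set 'M[F]_n} :=
  [set A : 'M[F]_n | symmetric_mx A && tridiagonal_mx A].

Definition STdet (F : finFieldType) (n : nat) (a : F) : {set 'M[F]_n} :=
  [set A in ST F n | \det A == a].

Definition IST (F : finFieldType) (n : nat) : {set 'M[F]_n} :=
  [set A in ST F n | \det A != 0].

Definition Ssum (F : finFieldType) (n : nat) : int :=
  \sum_(a in Uset F) chi a * #|STdet n a|%:Z.

(* Main.v *)
Require Import Defs.
From mathcomp Require Import all_boot all_order all_algebra.
From mathcomp Require Import fingroup cyclic.
From mathcomp Require Import ring.

Import GRing.Theory Num.Theory.

Local Open Scope ring_scope.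

(** Congruence by an invertible diagonal matrix maps symmetric tridiagonal
    matrices to symmetric tridiagonal matrices, and multiplies the determinant
    by the square of that of the diagonal matrix.  Hence |ST_n(a)| depends only
    on the class of a modulo nonzero squares.  Since q is odd there are two
    classes, each with (q - 1)/2 elements; if x and y are the values of
    |ST_n(a)| on them, then |IST_n| = (q - 1)/2 (x + y) and
    S_n = (q - 1)/2 (x - y). *)

Lemma in_Uset (F : finFieldType) (a : F) : (a \in Uset F) = (a != 0).
Proof. by rewrite inE unitfE. Qed.

Lemma QsetP (F : finFieldType) (a : F) :
  reflect (exists2 x, x != 0 & a = x ^+ 2) (a \in Qset F).
Proof.
rewrite inE in_Uset; apply: (iffP andP) => [[a0 /existsP [x /eqP ax]]|[x x0 ->]].
  by exists x => //; move: a0; rewrite ax expf_eq0.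
by rewrite expf_neq0 //; split=> //; apply/existsP; exists x.
Qed.

Lemma card_Uset (F : finFieldType) : #|Uset F|.+1 = #|F|.
Proof.
rewrite (eq_card (B := predC1 (0 : F))) => [|a]; last exact: in_Uset.
by rewrite cardC1 prednK //; apply/card_gt0P; exists 0.
Qed.

(** Lagrange in the additive group of [F] gives [#|F|] times 1 equal to 0; for odd [#|F|], having 2
    = 0 would reduce this to 1 = 0. *)
Lemma odd_card_two_neq0 (F : finFieldType) : odd #|F| -> (2%:R : F) != 0.
Proof.
move=> hq; apply/eqP => two0.
have := expg_cardG (in_setT (1 : F)).
rewrite cardsT FinRing.zmodXgE -[#|F|]odd_double_half hq.
rewrite -[(#|F|)./2.*2]mul2n mulrnDr mulrnA two0 mul0rn addr0.
by apply/eqP; exact: oner_neq0.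
Qed.

(** If [b] is the square of [y], its roots are [y] and [- y], distinct because 2 and [y] are
    nonzero. *)
Lemma card_sqr_fiber (F : finFieldType) (b : F) :
  odd #|F| -> b \in Qset F -> #|[set x : F | x ^+ 2 == b]| = 2%N.
Proof.
move=> hq /QsetP [y y0 ->].
rewrite (_ : [set x | _] = [set y; - y]); last first.
  by apply/setP => x; rewrite !inE eqf_sqr.
rewrite cards2 -addr_eq0 -mulr2n -mulr_natr mulf_neq0 //.
exact: odd_card_two_neq0.
Qed.

(** Squaring maps the units onto [Qset F] with fibers of size two. *)
Lemma card_Uset_Qset (F : finFieldType) :
  odd #|F| -> #|Uset F| = (#|Qset F| * 2)%N.
Proof.
move=> hq; rewrite -sum1_card.
rewrite (partition_big (fun x : F => x ^+ 2) (mem (Qset F))) /=; last first.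
  by move=> x; rewrite in_Uset => x0; apply/QsetP; exists x.
rewrite -sum_nat_const; apply: eq_bigr => b bQ.
rewrite -[RHS](card_sqr_fiber F b hq bQ) -sum1_card; apply: eq_bigl => x.
rewrite in_Uset inE andb_idl // => /eqP xb.
by case/QsetP: bQ xb => y y0 -> e; move: (expf_neq0 2 y0); rewrite -e expf_eq0.
Qed.

Lemma Qset_sub_Uset (F : finFieldType) : Qset F \subset Uset F.
Proof. by apply/subsetP => x; rewrite inE => /andP []. Qed.

Lemma card_Nset (F : finFieldType) : odd #|F| -> #|Nset F| = #|Qset F|.
Proof.
move=> hq; rewrite cardsD (setIidPr (Qset_sub_Uset F)) card_Uset_Qset //.
by rewrite muln2 -addnn addnK.
Qed.

(* Multiplication by a nonresidue maps Qset injectively into Nset; the two have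
   the same number of elements. *)
Lemma Nset_coset (F : finFieldType) (a : F) :
  odd #|F| -> a \in Nset F -> Nset F = [set a * b | b in Qset F].
Proof.
move=> hq; rewrite inE => /andP [aNQ]; rewrite in_Uset => a0.
apply/esym/eqP; rewrite eqEcard card_in_imset => [|x y _ _]; last exact: mulfI.
rewrite card_Nset // leqnn andbT; apply/subsetP => _ /imsetP [b /QsetP [x x0 ->] ->].
rewrite inE in_Uset mulf_neq0 ?expf_neq0 // andbT.
apply: contra aNQ => /QsetP [y y0 axy]; apply/QsetP; exists (y / x).
  by rewrite mulf_neq0 ?invr_eq0.
by rewrite expr_div_n -axy mulfK ?expf_neq0.
Qed.

(** Entry (i, j) is only rescaled, by d_i d_j, so zeros stay zeros. *)
Lemma diag_congr_ST (F : finFieldType) (n : nat) (d : 'rV[F]_n) (A : 'M[F]_n) :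
  A \in ST F n -> diag_mx d *m A *m diag_mx d \in ST F n.
Proof.
rewrite !inE => /andP [/eqP Asym Atri]; apply/andP; split.
  by rewrite /symmetric_mx !trmx_mul tr_diag_mx Asym mulmxA.
apply/forallP => i; apply/forallP => j; apply/implyP => ij.
move/forallP/(_ i)/forallP/(_ j)/implyP/(_ ij)/eqP: Atri => Aij.
by rewrite mul_mx_diag mul_diag_mx !mxE Aij mulr0 mul0r.
Qed.

Lemma leq_card_STdet (F : finFieldType) (n : nat) (a c : F) :
  (0 < n)%N -> c != 0 -> (#|STdet n a| <= #|STdet n (a * c ^+ 2)%R|)%N.
Proof.
case: n => // n _ c0.
(* A single entry [c] on the diagonal makes [\det D] equal to [c]; this is where a positive size
   matters. *)
pose D : 'M[F]_n.+1 := diag_mx (\row_i (if i == 0 then c else 1)).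
have detD : \det D = c.
  rewrite det_diag big_ord_recl mxE eqxx big1 ?mulr1 // => i _.
  by rewrite mxE.
have Du : D \in unitmx by rewrite unitmxE detD unitfE.
rewrite -(card_in_imset (f := fun A => D *m A *m D)); last first.
  by move=> A B _ _ /(can_inj (mulmxK Du)) /(can_inj (mulKmx Du)).
apply/subset_leq_card/subsetP => _ /imsetP [A + ->].
rewrite inE => /andP [AST /eqP <-].
by rewrite inE diag_congr_ST //= !det_mulmx detD mulrC mulrA mulrC -expr2.
Qed.

Lemma card_STdet_mul_sqr (F : finFieldType) (n : nat) (a c : F) :
  (0 < n)%N -> c != 0 -> #|STdet n (a * c ^+ 2)| = #|STdet n a|.
Proof.
move=> n0 c0; apply/eqP; rewrite eqn_leq leq_card_STdet // andbT.
(* The reverse inequality is the same lemma applied to [a * c ^+ 2] and [c^-1]. *)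
have {2}-> : a = a * c ^+ 2 * c^-1 ^+ 2.
  by rewrite exprVn mulfK ?expf_neq0.
by apply: leq_card_STdet => //; rewrite invr_eq0.
Qed.

Lemma card_STdet_Qset (F : finFieldType) (n : nat) (a : F) :
  (0 < n)%N -> a \in Qset F -> #|STdet n a| = #|STdet n (1 : F)|.
Proof.
by move=> n0 /QsetP [x x0 ->]; rewrite -[x ^+ 2]mul1r card_STdet_mul_sqr.
Qed.

Lemma card_STdet_Nset (F : finFieldType) (n : nat) (a b : F) :
  odd #|F| -> (0 < n)%N -> a \in Nset F -> b \in Nset F ->
  #|STdet n b| = #|STdet n a|.
Proof.
move=> hq n0 aN; rewrite (Nset_coset F a hq aN) => /imsetP [_ /QsetP [x x0 ->] ->].
exact: card_STdet_mul_sqr.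
Qed.

Lemma card_IST_sum (F : finFieldType) (n : nat) :
  #|IST F n| = (\sum_(a in Uset F) #|STdet n a|)%N.
Proof.
rewrite -sum1_card (partition_big (fun A : 'M_n => \det A) (mem (Uset F))) /=.
  apply: eq_bigr => a; rewrite in_Uset => a0.
  rewrite -sum1_card; apply: eq_bigl => A; rewrite !inE -!andbA.
  by case: (\det A =P a) => [->|_]; rewrite ?a0 ?andbF.
by move=> A; rewrite inE in_Uset => /andP [].
Qed.

(** The codomain is general so as to cover both the count of [IST F n] in [nat] and the signed sum
    [Ssum F n] in [int]. *)
Lemma sum_Uset (F : finFieldType) (V : nmodType) (f : F -> V) (x y : V) :
  odd #|F| -> {in Qset F, forall a, f a = x} -> {in Nset F, forall a, f a = y} ->
  \sum_(a in Uset F) f a = (x + y) *+ #|Qset F|.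
Proof.
move=> hq fQ fN; rewrite (big_setID (Qset F)) /=.
rewrite (setIidPr (Qset_sub_Uset F)) (eq_bigr _ fQ) (eq_bigr _ fN) !sumr_const.
by rewrite card_Nset // mulrnDl.
Qed.

Theorem theorem2p13 (F : finFieldType) (hq : odd #|F|) (n : nat)
    (hn : (0 < n)%N) (a : F) (ha : a \in Uset F) :
  (a \in Qset F ->
     #|STdet n a|%:R =
       (#|IST F n|%:R + (Ssum F n)%:~R) / (#|F|%:R - 1) :> rat) /\
  (a \in Nset F ->
     #|STdet n a|%:R =
       (#|IST F n|%:R - (Ssum F n)%:~R) / (#|F|%:R - 1) :> rat).
Proof.
have Q1 : 1 \in Qset F by apply/QsetP; exists 1; rewrite ?oner_neq0 ?expr1n.
have [b bN] : exists b, b \in Nset F.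
  by apply/card_gt0P; rewrite card_Nset //; apply/card_gt0P; exists 1.
set x := #|STdet n (1 : F)|; set y := #|STdet n b|.
have cQ c : c \in Qset F -> #|STdet n c| = x by exact: card_STdet_Qset.
have cN c : c \in Nset F -> #|STdet n c| = y.
  by move=> h; exact: card_STdet_Nset.
have -> : #|IST F n| = (x + y) *+ #|Qset F|.
  by rewrite card_IST_sum; exact: (sum_Uset F nat).
have -> : Ssum F n = (x%:Z - y%:Z) *+ #|Qset F|.
  apply: sum_Uset => // c cin; rewrite /chi.
    by rewrite cin mul1r cQ.
  by case/setDP: (cin) => _ /negbTE ->; rewrite cin mulN1r cN.
have q0 : #|Qset F|%:R != 0 :> rat.
  by rewrite pnatr_eq0 -lt0n; apply/card_gt0P; exists 1.
(* The denominator q - 1 becomes [#|Qset F| * 2], whose factor [#|Qset F|] cancels by [q0]. *)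
rewrite -card_Uset card_Uset_Qset // -natr1 addrK.
rewrite !rmorphMn rmorphB /= -!pmulrn -[(x + y)%R]/(x + y)%N natrD natrM.
by split=> [/cQ ->|/cN ->]; field.
Qed.
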